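(* Let $U$ be a nonempty open convex cone in $E=\mathbb{R}^n$. Let $\phi:E\to\mathbb{R}$ be a continuous function which is differentiable on $U$, and let $F=d\phi:U\to E^*$ be its differential. Let $$C_1=\{u'\in E^*:\ (\forall u\in U)\ (u,u')\ge\phi(u)\}$$ and let $C_1^o$ be the interior of $C_1$. Assume: (1) $\phi$ is concave on $U$; (2) $\phi$ is positively 1-homogeneous; (3) $\phi>0$ on $U$, and $\phi=0$ on $E\setminus U$. Then $$C_1^o\subset\mathbb{R}^{\ge1}F(U)\subset C_1 .$$
   Context: $E^*$ is the dual space of $E$ and $(u,u')$ is the natural pairing of $E$ with $E^*$. $\phi$ is positively 1-homogeneous if $\phi(\alpha x)=\alpha\phi(x)$ for all real $\alpha>0$. For a set $W$, $\mathbb{R}^{\ge1}W=\{rw:\ r\in\mathbb{R},\ r\ge1,\ w\in W\}$. *)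

(* Defs.v *)
From HB Require Import structures.
From mathcomp Require Import all_boot all_order all_algebra.
From mathcomp Require Import all_classical all_reals all_analysis.

Set Implicit Arguments.
Unset Strict Implicit.
Unset Printing Implicit Defensive.

Import Order.TTheory GRing.Theory Num.Theory.
Import numFieldNormedType.Exports.

Local Open Scope classical_set_scope.
Local Open Scope convex_scope.
Local Open Scope ring_scope.

(* E = R^n is the space of row vectors 'rV[R]_n.  Its dual E^* is the space of
   column vectors, with its usual topology; the functional given by u' sends u
   to the scalar u *m u', and every functional arises so (pairing_covector). *)
Notation dual R n := 'cV[R]_n.

Definition pairing (R : realType) (n : nat) (u : 'rV[R]_n) (u' : dual R n) : R :=
  (u *m u') 0 0.

Definition covector (R : realType) (n : nat) (l : 'rV[R]_n -> R) : dual R n :=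
  \col_i l (delta_mx 0 i).

Lemma pairing_covector (R : realType) (n : nat) (l : {linear 'rV[R]_n -> R^o})
    (u : 'rV[R]_n) :
  pairing u (covector l) = l u.
Proof.
rewrite /pairing /covector mxE [in RHS](row_sum_delta u) linear_sum.
by apply: eq_bigr => i _; rewrite mxE linearZ.
Qed.

Lemma covector_pairing (R : realType) (n : nat) (u' : dual R n) :
  covector (fun u => pairing u u') = u'.
Proof. by apply/colP => i; rewrite mxE /pairing -rowE mxE. Qed.

Definition differential (R : realType) (n : nat) (phi : 'rV[R]_n -> R)
    (u : 'rV[R]_n) : dual R n :=
  covector ('d phi u).

(* Membership of the apex 0 is not required. *)
Definition cone (R : realType) (n : nat) (U : set 'rV[R]_n) : Prop :=
  forall (a : R) (u : 'rV[R]_n), 0 < a -> U u -> U (a *: u).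

(* The library's convex_function with the inequality reversed. *)
Definition concave_function (R : numFieldType) (E : lmodType R)
    (D : set (convex_lmodType E)) (f : convex_lmodType E -> R^o) : Prop :=
  forall t : {i01 R},
    {in D &, forall x y : convex_lmodType E,
      f x <| t |> f y <= f (x <| t |> y)}.

Definition pos_homogeneous (R : realType) (n : nat) (phi : 'rV[R]_n -> R) : Prop :=
  forall (a : R) (x : 'rV[R]_n), 0 < a -> phi (a *: x) = a * phi x.

Definition ge1_multiples (R : realType) (n : nat) (W : set (dual R n)) :
    set (dual R n) :=
  [set r *: w | r in [set r : R | 1 <= r] & w in W].

Definition C1 (R : realType) (n : nat) (U : set 'rV[R]_n) (phi : 'rV[R]_n -> R) :
    set (dual R n) :=
  [set u' | forall u, U u -> phi u <= pairing u u'].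

(* Main.v *)
(* If w is interior to C1 then <u, w> dominates a multiple of |u| on U, so the
   slice <u, w> = 1 of the cone is bounded and phi attains its maximum M there
   at some u.  Since u is in U, M = phi u <= <u, w> = 1, and by homogeneity
   M <., w> - phi is nonnegative on U and vanishes at u; hence
   d phi(u) = M w, that is w = M^-1 F(u).  Conversely, concavity and
   homogeneity make phi superadditive, so d phi(u) v >= phi v > 0. *)
Require Import Defs.
From mathcomp Require Import all_boot all_order all_algebra.
From mathcomp Require Import all_classical all_reals all_analysis.

Import Order.TTheory GRing.Theory Num.Theory.
Import numFieldNormedType.Exports.

Local Open Scope classical_set_scope.
Local Open Scope ring_scope.

Set Implicit Arguments.
Unset Strict Implicit.

Lemma pairingDl (R : realType) (n : nat) (u v : 'rV[R]_n) (w : dual R n) :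
  pairing (u + v) w = pairing u w + pairing v w.
Proof. by rewrite /pairing mulmxDl mxE. Qed.

Lemma pairingZl (R : realType) (n : nat) (a : R) (u : 'rV[R]_n) (w : dual R n) :
  pairing (a *: u) w = a * pairing u w.
Proof. by rewrite /pairing -scalemxAl mxE. Qed.

Lemma pairingDr (R : realType) (n : nat) (u : 'rV[R]_n) (v w : dual R n) :
  pairing u (v + w) = pairing u v + pairing u w.
Proof. by rewrite /pairing mulmxDr mxE. Qed.

Lemma pairingZr (R : realType) (n : nat) (a : R) (u : 'rV[R]_n) (w : dual R n) :
  pairing u (a *: w) = a * pairing u w.
Proof. by rewrite /pairing -scalemxAr mxE. Qed.

Lemma pairing_deltar (R : realType) (n : nat) (u : 'rV[R]_n) (i : 'I_n) :
  pairing u (delta_mx i 0) = u 0 i.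
Proof. by rewrite /pairing -colE mxE. Qed.

Lemma pairing_deltal (R : realType) (n : nat) (w : dual R n) (i : 'I_n) :
  pairing (delta_mx 0 i) w = w i 0.
Proof. by rewrite /pairing -rowE mxE. Qed.

Lemma pairing_continuous (R : realType) (n : nat) (w : dual R n) :
  continuous (fun u : 'rV[R]_n => pairing u w).
Proof.
have -> : (fun u : 'rV[R]_n => pairing u w) = (fun u => \sum_i u 0 i * w i 0).
  by apply/funext => u; rewrite /pairing mxE.
apply: continuous_big => [|i _ u]; first exact: add_continuous.
by apply: cvgMr_tmp; [exact: nbhs_filter|exact: coord_continuous].
Qed.

(** Restricting to [h > 0] lets later estimates divide by [h] and apply positive homogeneity without
    sign cases. *)
Lemma differential_right_quotient (R : realType) (n : nat)
    (phi : 'rV[R]_n -> R) (u v : 'rV[R]_n) :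
  differentiable phi u ->
  h^-1 * (phi (h *: v + u) - phi u) @[h --> 0^'+] -->
    pairing v (differential phi u).
Proof.
move=> dphi.
rewrite pairing_covector -deriveE//.
by apply: cvg_dnbhs_at_right; exact: diff_derivable.
Qed.

Lemma differential_le (R : realType) (n : nat)
    (phi : 'rV[R]_n -> R) (u v : 'rV[R]_n) (c : R) :
  differentiable phi u ->
  (\forall h \near 0^'+, phi (h *: v + u) <= phi u + h * c) ->
  pairing v (differential phi u) <= c.
Proof.
move=> /differential_right_quotient dphi phi_le.
apply: (cvgr_to_le (dphi v)); near=> h.
have h0 : 0 < h by near: h; exact: nbhs_right_gt.
by rewrite mulrC ler_pdivrMr// lerBlDl [c * _]mulrC; near: h.
Unshelve. all: by end_near. Qed.

Lemma differential_ge (R : realType) (n : nat)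
    (phi : 'rV[R]_n -> R) (u v : 'rV[R]_n) (c : R) :
  differentiable phi u ->
  (\forall h \near 0^'+, phi u + h * c <= phi (h *: v + u)) ->
  c <= pairing v (differential phi u).
Proof.
move=> /differential_right_quotient dphi phi_ge.
apply: (cvgr_to_ge (dphi v)); near=> h.
have h0 : 0 < h by near: h; exact: nbhs_right_gt.
by rewrite mulrC ler_pdivlMr// lerBrDl [c * _]mulrC; near: h.
Unshelve. all: by end_near. Qed.

(** Concavity at the midpoint, with the factor 1/2 pulled out of [phi] by homogeneity and
    cancelled. *)
Lemma concave_superadditive (R : realType) (n : nat) (U : set 'rV[R]_n)
    (phi : 'rV[R]_n -> R) (u v : 'rV[R]_n) :
  concave_function U phi -> pos_homogeneous phi -> U u -> U v ->
  phi u + phi v <= phi (u + v).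
Proof.
move=> cphi hphi Uu Uv.
have half0 : 0 <= 2^-1 :> R by rewrite invr_ge0 ler0n.
have half1 : 2^-1 <= 1 :> R by rewrite invf_le1 ?ler1n.
have := cphi (Itv01 half0 half1) u v (mem_set Uu) (mem_set Uv).
have halfC : unstable.onem 2^-1 = 2^-1 :> R.
  by rewrite /unstable.onem [X in X - _]splitr mul1r addrK.
rewrite convRE /conv/= halfC -!scalerDr hphi ?invr_gt0//.
by move=> le_half; rewrite -(@ler_pM2l _ 2^-1) ?invr_gt0//; exact: le_half.
Qed.

(** Moving [w] slightly along a coordinate covector stays in [C1], so the pairing with [u] remains
    at least [phi u > 0]. *)
Lemma interior_lower_bound (R : realType) (n : nat) (U : set 'rV[R]_n)
    (phi : 'rV[R]_n -> R) (w : dual R n) :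
  (forall u, U u -> 0 < phi u) -> (C1 U phi)° w ->
  exists2 e : R, 0 < e & forall u i, U u -> e * `|u 0 i| <= pairing u w.
Proof.
move=> phi0 /nbhs_ballP[e /= e0 ballC].
exists (e / 2) => [|u i Uu]; first by rewrite divr_gt0.
have Cd (d : R) : `|d| < e -> 0 <= pairing u w + d * u 0 i.
  move=> de; rewrite -(pairing_deltar u) -pairingZr -pairingDr.
  apply: (le_trans (ltW (phi0 u Uu))); apply: ballC Uu; split => // j k.
  (* Each entry of the perturbation is [d] or 0, hence of modulus below [e]. *)
  rewrite -ball_normE/= !mxE [k]ord1 opprD addrA subrr add0r normrN normrM.
  apply: le_lt_trans de; rewrite ler_piMr// normr_nat.
  by case: (_ && _); rewrite ?ler01 ?lexx.
have e20 : 0 < e / 2 by rewrite divr_gt0.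
have e2 : `|e / 2| < e.
  by rewrite gtr0_norm// ltr_pdivrMr// ltr_pMr// ltr1n.
(* The choices [d = e / 2] and [d = - (e / 2)] give the two sides of the absolute value. *)
rewrite -{1}(gtr0_norm e20) -normrM ler_norml -subr_ge0 opprK addrC Cd//=.
by rewrite -subr_ge0 -mulNr Cd// normrN.
Qed.

Lemma exists_maximizer (R : realType) (n : nat) (U : set 'rV[R]_n)
    (phi : 'rV[R]_n -> R) (w : dual R n) :
  U !=set0 -> continuous phi -> pos_homogeneous phi ->
  (forall u, U u -> 0 < phi u) -> (forall u, (~` U) u -> phi u = 0) ->
  (C1 U phi)° w ->
  exists u, [/\ U u, pairing u w = 1 &
    forall v, U v -> phi v <= phi u * pairing v w].
Proof.
move=> [u1 Uu1] cphi hphi phi0 phiN Cw.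
have C1w : C1 U phi w by exact: interior_subset Cw.
have pw0 v : U v -> 0 < pairing v w.
  by move=> Uv; exact: lt_le_trans (phi0 v Uv) (C1w v Uv).
have [e e0 bnd] := interior_lower_bound phi0 Cw.
(* [K] is not confined to [U]: the slice of the open cone need not be closed. The cube of half-side
   [e^-1] contains that slice, since [e * |u_i| <= 1] there. *)
pose K := [set u : 'rV[R]_n | forall i, `[- e^-1, e^-1]%classic (u ord0 i)] `&`
  (fun u => pairing u w) @^-1` [set 1].
have Knorm v : U v -> K ((pairing v w)^-1 *: v).
  move=> Uv; have p0 := pw0 v Uv; split; last first.
    by rewrite /= pairingZl mulVf// gt_eqF.
  move=> i /=; rewrite in_itv/= -ler_norml mxE normrM gtr0_norm ?invr_gt0//.
  by rewrite -[e^-1]mulr1 ler_pdivlMl// mulrCA ler_pdivrMl// mulr1 bnd.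
have Kcompact : compact K.
  apply: compact_closedI; first by
    apply: (@rV_compact _ _ (fun=> `[- e^-1, e^-1]%classic)) => i;
    exact: segment_compact.
  apply: closed_comp; last exact: closed_eq.
  by move=> u _; exact: pairing_continuous.
have K0 : K !=set0 by exists ((pairing u1 w)^-1 *: u1); exact: Knorm.
have [u /set_mem[_ /= uw1] umax] :=
  compact_EVT_max K0 Kcompact (continuous_subspaceT cphi).
have vmax v : U v -> phi v <= phi u * pairing v w.
  move=> Uv; rewrite mulrC -ler_pdivrMl ?pw0// -hphi ?invr_gt0 ?pw0//.
  by apply: umax; exact/mem_set/Knorm.
(* A maximizer outside [U] would have [phi u = 0], forcing [phi u1 <= 0]. *)
exists u; split => //; apply: contrapT => /phiN phiu0.
by have := vmax _ Uu1; rewrite phiu0 mul0r leNgt phi0.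
Qed.

Lemma ge1_multiples_differential_sub (R : realType) (n : nat)
    (U : set 'rV[R]_n) (phi : 'rV[R]_n -> R) :
  cone U -> (forall u, U u -> differentiable phi u) ->
  concave_function U phi -> pos_homogeneous phi ->
  (forall u, U u -> 0 < phi u) ->
  ge1_multiples (differential phi @` U) `<=` C1 U phi.
Proof.
move=> coneU dphi cphi hphi phi0 _ [r /= r1 [_ [u Uu <-] <-]] v Uv.
rewrite pairingZr.
have phi_le : phi v <= pairing v (differential phi u).
  apply: differential_ge; first exact: dphi.
  near=> h; have h0 : 0 < h by near: h; exact: nbhs_right_gt.
  (* Superadditivity is applied to [h *: v] and [u], with [h * phi v = phi (h *: v)]. *)
  rewrite addrC -hphi//.
  by apply: concave_superadditive cphi hphi _ Uu; exact: coneU.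
(* Scaling by [r >= 1] only increases a pairing that is at least [phi v > 0]. *)
by apply: (le_trans phi_le); rewrite ler_peMl// (le_trans _ phi_le)// ltW// phi0.
Unshelve. all: by end_near. Qed.

Lemma interior_sub_ge1_multiples (R : realType) (n : nat)
    (U : set 'rV[R]_n) (phi : 'rV[R]_n -> R) :
  U !=set0 -> open U -> continuous phi ->
  (forall u, U u -> differentiable phi u) -> pos_homogeneous phi ->
  (forall u, U u -> 0 < phi u) -> (forall u, (~` U) u -> phi u = 0) ->
  (C1 U phi)° `<=` ge1_multiples (differential phi @` U).
Proof.
move=> U0 oU cphi dphi hphi phi0 phiN w Cw.
have [u [Uu uw1 umax]] := exists_maximizer U0 cphi hphi phi0 phiN Cw.
have phiu0 := phi0 u Uu.
have d_le v : pairing v (differential phi u) <= phi u * pairing v w.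
  apply: differential_le; first exact: dphi.
  (* As [U] is open, the maximality bound applies at [h *: v + u] for every direction [v], even
     outside [U]. *)
  have : \forall h \near 0^'+, U (h *: v + u).
    have lim_u : h *: v + u @[h --> (0 : R)] --> u.
      rewrite -[X in _ --> X]add0r -(scale0r v).
      by apply: cvgD; [apply: cvgZr_tmp; exact: cvg_id|exact: cvg_cst].
    exact: (cvg_at_right_filter lim_u) (open_nbhs_nbhs (conj oU Uu)).
  apply: filterS => h /umax.
  by rewrite pairingDl pairingZl uw1 mulrDr mulr1 mulrCA [leRHS]addrC.
(* Both sides are linear in [v], so the inequality at [-v] is the reverse one. *)
have dE v : pairing v (differential phi u) = phi u * pairing v w.
  apply/eqP; rewrite eq_le d_le/= -lerN2.
  by have := d_le (-1 *: v); rewrite !pairingZl mulrCA !mulN1r.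
(* The factor is at least 1 because [w] lies in [C1], whence [phi u <= pairing u w = 1]. *)
exists (phi u)^-1.
  by rewrite /= invf_ge1// -[leRHS]uw1; exact: (interior_subset Cw) Uu.
exists (differential phi u); first by exists u.
apply/colP => i; rewrite -!pairing_deltal pairingZr dE mulKf// gt_eqF//.
Qed.

Unset Implicit Arguments.

Theorem theorem5p2 (R : realType) (n : nat) (U : set 'rV[R]_n)
    (phi : 'rV[R]_n -> R)
    (U_neq0 : U !=set0)
    (U_open : open U)
    (U_convex : convex_set U)
    (U_cone : cone U)
    (phi_continuous : continuous phi)
    (phi_differentiable : forall u, U u -> differentiable phi u)
    (phi_concave : concave_function U phi)
    (phi_homogeneous : pos_homogeneous phi)
    (phi_gt0 : forall u, U u -> 0 < phi u)
    (phi_eq0 : forall u, (~` U) u -> phi u = 0) :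
  interior (C1 U phi) `<=` ge1_multiples (differential phi @` U) /\
  ge1_multiples (differential phi @` U) `<=` C1 U phi.
Proof.
split; first exact: interior_sub_ge1_multiples.
exact: ge1_multiples_differential_sub.
Qed.
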